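(* Let $T$ be a triangulation of a convex $m$-gon ($m\ge2$) with vertices $1,\dots,m$ in cyclic order (indices modulo $m$), equipped with an admissible labelling. Then at least one of the following holds: (0) $m<4$, and the labelling is either empty or consists of a single triangle labelled $1$. (1) There is $k$ such that $(k-1,k,k+1)$ is a triangle of $T$ labelled $1$. Removing it yields an admissible labelling of a triangulation of an $(m-1)$-gon. (2) $m$ is odd, and there is $k$ such that the quadrilateral $(k-1,k,k+1,k+2)$ is a square of $T$ labelled $(c,-c)$. Removing it and multiplying all remaining labels by $-1$ yields an admissible labelling of a triangulation of an $(m-2)$-gon. (3) $m$ is even, and there is $k$ such that $(k-1,k,k+1)$ is a triangle labelled $-1$. Removing it and multiplying all remaining labels by $-1$ yields an admissible labelling of a triangulation of an $(m-1)$-gon. (4) There are $j,k$ with $|j-k|>1$ such that $(j-1,j,j+1,j+2)$ and $(k-1,k,k+1,k+2)$ are squares labelled $(c,-c)$ and $(d,-d)$. Removing both yields an admissible labelling of a triangulation of an $(m-4)$-gon. (5) There are $j,k$ with $|j-k|>1$ such that $(j-1,j,j+1)$ and $(k-1,k,k+1)$ are triangles labelled $-1$. Removing both yields an admissible labelling of a triangulation of an $(m-2)$-gon.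
   Context: A triangulation of an $m$-gon is a subdivision into $m-2$ triangles by non-crossing diagonals; for $m=2$ it has no triangles. A labelling assigns an integer $a_t$ to each triangle $t$. Let $d$ be the number of negative labels plus half the number of labels equal to $0$; if $d$ is an integer, the sign is $(-1)^d$. A labelling is admissible if: (i) the triangles $t$ with $a_t\notin\{1,-1\}$ are partitioned into two-element sets $\{t_1,t_2\}$ (''squares'') of triangles sharing an edge with $a_{t_1}=-a_{t_2}$; (ii) $d$ is an even integer. A square ''$(k-1,k,k+1,k+2)$ labelled $(c,-c)$'' means a square of the admissible labelling whose two triangles together form the quadrilateral with vertices $k-1,k,k+1,k+2$, with labels $c$ and $-c$. Removing a triangle $(k-1,k,k+1)$ deletes vertex $k$; removing a square $(k-1,k,k+1,k+2)$ deletes vertices $k,k+1$. *)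

(* Defs.v *)
From HB Require Import structures.
From mathcomp Require Import all_boot all_order all_algebra.
Set Implicit Arguments. Unset Strict Implicit. Unset Printing Implicit Defensive.
Import Order.TTheory GRing.Theory Num.Theory.

(* A convex polygon is given by the sequence P of its (distinct, natural-number)
   vertex names in cyclic order.  A triangle is a seq of 3 distinct vertices
   (considered up to permutation). *)

Definition between (P : seq nat) (a b x : nat) : bool :=
  let i := index a P in let j := index b P in let p := index x P in
  (minn i j < p < maxn i j)%N.

Definition crossing (P : seq nat) (a b c d : nat) : bool :=
  uniq [:: a; b; c; d] && (between P a b c != between P a b d).

Definition no_cross (P : seq nat) (t1 t2 : seq nat) : bool :=
  all (fun a => all (fun b => all (fun c => all (fun d =>
    ~~ crossing P a b c d) t2) t2) t1) t1.

Definition is_tri (P : seq nat) (t : seq nat) : bool :=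
  [&& size t == 3, uniq t & all (fun x => x \in P) t].

(* T is a triangulation of the convex polygon P (with >= 2 vertices):
   size P - 2 distinct triangles on vertices of P, with pairwise
   non-crossing sides (i.e. a subdivision by non-crossing diagonals). *)
Definition triangulation (P : seq nat) (T : seq (seq nat)) : Prop :=
  [/\ uniq P, (2 <= size P)%N, all (is_tri P) T, size T = (size P - 2)%N &
      pairwise (fun t1 t2 => ~~ perm_eq t1 t2 && no_cross P t1 t2) T].

Definition lab_tri := seq (seq nat * int).

Definition share_edge (t1 t2 : seq nat) : bool := (count (fun x => x \in t2) t1 == 2)%N.

Definition ltri (L : lab_tri) (i : nat) : seq nat := (nth ([::], 0%R) L i).1.
Definition llab (L : lab_tri) (i : nat) : int := (nth ([::], 0%R) L i).2.

Definition admissible (L : lab_tri) : Prop :=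
  (exists Q : {set {set 'I_(size L)}},
      partition Q [set i : 'I_(size L) | llab L i \notin [:: 1%R; (-1)%R]] /\
      forall B, B \in Q -> #|B| = 2 /\
        forall i j, i \in B -> j \in B -> i != j ->
          share_edge (ltri L i) (ltri L j) /\ llab L i = (- llab L j)%R)
  /\ exists e : nat,
       (2 * count (fun p : seq nat * int => (p.2 < 0)%R) L
          + count (fun p : seq nat * int => p.2 == 0%R) L = 4 * e)%N.

Definition adm_triangulation (P : seq nat) (L : lab_tri) : Prop :=
  triangulation P (map fst L) /\ admissible L.

(* vertex i of the m-gon with vertices 1..m, indices taken modulo m *)
Definition cyc (m i : nat) : nat := ((i + m.-1) %% m).+1.

Definition neg_labels (L : lab_tri) : lab_tri := map (fun p => (p.1, (- p.2)%R)) L.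
Definition del_vertices (vs : seq nat) (P : seq nat) : seq nat :=
  filter (fun x => x \notin vs) P.
Definition del_tris (ts : seq (seq nat)) (L : lab_tri) : lab_tri :=
  filter (fun p => p.1 \notin ts) L.

Definition ear (m : nat) (L : lab_tri) (k : nat) (c : int) (t : seq nat) : Prop :=
  (t, c) \in L /\ perm_eq t [:: cyc m k.-1; k; cyc m k.+1].

Definition square (m : nat) (L : lab_tri) (k : nat) (t1 t2 : seq nat) : Prop :=
  exists c : int, [/\ (t1, c) \in L, (t2, (- c)%R) \in L, c \notin [:: 1%R; (-1)%R],
    share_edge t1 t2 &
    perm_eq (undup (t1 ++ t2)) [:: cyc m k.-1; k; cyc m k.+1; cyc m k.+2]].

(* Main.v *)
Require Import Defs.
From HB Require Import structures.
From mathcomp Require Import all_boot all_order all_algebra.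
From mathcomp Require Import zify.
Set Implicit Arguments. Unset Strict Implicit. Unset Printing Implicit Defensive.
Import Order.TTheory GRing.Theory Num.Theory.

(* Glueing the triangles of every square cuts the polygon into pieces (single
   triangles labelled 1 or -1, and squares) whose dual graph is a tree.  Unless
   there is only one piece, two pieces are leaves of this tree, and a leaf is
   exactly a piece of the shape required in (1)-(5).  A piece other than a triangle
   labelled 1 contributes 1 to d, so removing one such piece and negating the other
   labels turns 2d into 2(m - 2 - s) - (2d - 2), where s is the number of triangles of
   the piece; this is divisible by 4 when s = 2 and m is odd, or s = 1 and m is even.
   Hence the parity of m decides between (2)-(3), one leaf, and (4)-(5), two leaves of
   the same kind; a single piece contributing 1 to d is excluded as d is even.

   The leaves are found without the dual tree.  A noncrossing family has at most
   b - a - 1 triangles inside a vertex interval [a, b], and if this bound is attained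
   then some triangle (a, x, b) splits the interval into two for which it is attained
   again, so that one can descend along intervals, starting from [1, m]. *)

(** * Counting noncrossing triangles in an interval *)

(** With vertices numbered along the polygon, two chords cross exactly when their endpoints
    interleave. The interleaving that starts with the chord of [s] is the same clause with [t] and
    [s] exchanged. *)
Definition noncrossing (T : seq (seq nat)) : Prop :=
  [/\ uniq T, forall t, t \in T -> size t = 3 /\ uniq t,
      forall t s, t \in T -> s \in T -> t =i s -> t = s &
      forall t s, t \in T -> s \in T -> forall a b c d, a \in t -> b \in t ->
        c \in s -> d \in s -> ~ [/\ a < c, c < b & b < d]].

Definition inside (a b : nat) (t : seq nat) : bool := all (fun x => a <= x <= b) t.

Lemma triangle_sorted (t : seq nat) : size t = 3 -> uniq t ->
  exists u v w, [/\ u < v, v < w & t =i [:: u; v; w]].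
Proof.
move=> sz un; have so := sort_sorted leq_total t.
have me := mem_sort leq t; have := size_sort leq t; rewrite sz.
have: uniq (sort leq t) by rewrite sort_uniq.
case: (sort leq t) so me => [|u [|v [|w [|? ?]]]] //= so me un' _.
exists u, v, w; split; last by move=> x; rewrite -me.
  by move: un' so; rewrite !inE; lia.
by move: un' so; rewrite !inE; lia.
Qed.

Lemma not_interleaved (a b c d : nat) : ~ [/\ a < c, c < b & b < d] ->
  [|| c <= a, b <= c | d <= b].
Proof. by move=> K; apply/negPn/negP => C; apply: K; split; lia. Qed.

Lemma insideE (a b u v w : nat) (t : seq nat) : t =i [:: u; v; w] ->
  inside a b t = [&& a <= u <= b, a <= v <= b & a <= w <= b].
Proof. by move=> /eq_all_r E; rewrite /inside E /= andbT. Qed.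

Lemma eq_seq3 (t : seq nat) (u v w a b c : nat) : t =i [:: u; v; w] ->
  u = a -> v = b -> w = c -> t =i [:: a; b; c].
Proof. by move=> E <- <- <-. Qed.

Lemma mem3 (t : seq nat) (u v w : nat) : t =i [:: u; v; w] ->
  [/\ u \in t, v \in t & w \in t].
Proof. by move=> E; rewrite !E !inE !eqxx !orbT. Qed.

(** Take for [x] the largest vertex below [b] that some triangle of the interval joins to [a]. A
    triangle with vertices on both sides of [x] must not cross the chord from [a] to [x], so it
    contains [a]; by the choice of [x] its last vertex is [b], and then its middle one is [x]. If
    nothing below [b] is joined to [a], no triangle of the interval contains [a], and [a.+1]
    serves. *)
Lemma split_point (T : seq (seq nat)) (a b : nat) : noncrossing T -> a.+1 < b ->
  exists2 x, a < x < b & forall t, t \in T -> inside a b t ->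
    [\/ inside a x t, inside x b t | t =i [:: a; x; b]].
Proof.
case=> unT T3 _ nc ab.
pose P y := (a < y < b) && has (fun t => [&& inside a b t, a \in t & y \in t]) T.
case: (boolP (has P (iota a b))) => [/hasP[y0 _ Py0]|/hasPn noP].
  have exP : exists y, P y by exists y0.
  have ubP y : P y -> y <= b by move=> /andP[]; lia.
  case: (ex_maxnP exP ubP) => x /andP[axb /hasP[t0 t0T /and3P[in0 at0 xt0]]] xmax.
  exists x => // t tT tab.
  have [sz un] := T3 _ tT; have [u [v [w [uv vw E]]]] := triangle_sorted sz un.
  have [ut vt wt] := mem3 E.
  have nbr y : a \in t -> y \in t -> a < y < b -> y <= x.
    by move=> at_ yt ayb; apply: xmax; rewrite /P ayb; apply/hasP; exists t => //; apply/and3P.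
  rewrite !(insideE _ _ E) in tab *.
  have n1 := not_interleaved (nc _ _ t0T tT a x u w at0 xt0 ut wt).
  have n2 := not_interleaved (nc _ _ t0T tT a x v w at0 xt0 vt wt).
  case: (leqP w x) => wx; first by constructor 1; clear - tab wx uv vw; lia.
  case: (leqP x u) => xu; first by constructor 2; clear - tab xu uv vw; lia.
  have ua : u = a by clear - n1 xu wx tab; lia.
  rewrite -ua in nbr.
  have wb : w = b.
    apply/eqP/negPn/negP => wb; have := nbr w ut wt.
    by clear - wb wx tab uv vw ua; lia.
  have vx := nbr v ut vt; constructor 3; apply: (eq_seq3 E) => //.
  by clear - n2 uv vw ua wb wx tab vx axb; lia.
exists a.+1; first lia.
move=> t tT tab.
have [sz un] := T3 _ tT; have [u [v [w [uv vw E]]]] := triangle_sorted sz un.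
have [ut vt wt] := mem3 E.
have tab' := tab; rewrite (insideE _ _ E) in tab'.
constructor 2; rewrite (insideE _ _ E).
case: (ssrnat.ltngtP a u) => au; [lia|lia|].
have := noP v; rewrite mem_iota; move=> /(_ ltac:(lia)) /negP[].
apply/andP; split; first lia.
by apply/hasP; exists t => //; rewrite tab vt au ut.
Qed.

Definition ntri (T : seq (seq nat)) (a b : nat) : nat := count (inside a b) T.

Lemma count_le1 (T : eqType) (p : pred T) (s : seq T) : uniq s ->
  (forall x y, x \in s -> y \in s -> p x -> p y -> x = y) -> count p s <= 1.
Proof.
move=> us H; rewrite -size_filter.
have: uniq (filter p s) by rewrite filter_uniq.
have: forall x, x \in filter p s -> (x \in s) && p x.
  by move=> x; rewrite mem_filter andbC.
case: (filter p s) => [|x [|y r]] //= K; rewrite inE.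
have /andP[xs px] := K x (mem_head _ _).
have /andP[ys py] : (y \in s) && p y by apply: K; rewrite !inE eqxx orbT.
by rewrite (H x y) // eqxx.
Qed.

(** Members of [T] with the same vertices are equal, so the third alternative accounts for at most
    one triangle. *)
Lemma ntri_split (T : seq (seq nat)) (a b x : nat) : noncrossing T ->
  (forall t, t \in T -> inside a b t ->
    [\/ inside a x t, inside x b t | t =i [:: a; x; b]]) ->
  ntri T a b <= ntri T a x + ntri T x b + has (perm_eq [:: a; x; b]) T.
Proof.
case=> unT T3 inj nc H.
have c1 : count (perm_eq [:: a; x; b]) T <= has (perm_eq [:: a; x; b]) T.
  rewrite has_count; case: posnP => [->//|_] /=; apply: count_le1 => // t s tT sT.
  move=> /perm_mem pt /perm_mem ps; apply: inj => // y.
  by rewrite -pt ps.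
apply: (leq_trans _ (leq_add (leqnn _) c1)).
rewrite /ntri -!size_filter.
have sub : forall t, t \in T -> inside a b t ->
   [|| inside a x t, inside x b t | perm_eq [:: a; x; b] t].
  move=> t tT tab; have [sz un] := T3 _ tT.
  case: (H t tT tab) => [->//|->|E]; first by rewrite orbT.
  apply/or3P; constructor 3; apply: uniq_perm => //.
  by apply: (leq_size_uniq un) => [y|]; rewrite ?E ?sz.
rewrite !size_filter.
elim: T sub {unT T3 inj nc H c1} => //= t T IH sub.
have := IH (fun s sT => sub s (mem_behead (s := t :: T) sT)).
have := sub t (mem_head _ _).
by case: (inside a b t) => [/(_ isT)|_]; case: (inside a x t); case: (inside x b t);
  case: (perm_eq _ t) => //=; lia.
Qed.

(** Strong induction on the length: the bounds for the two halves of a split add up to [b - a - 2],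
    and the triangle over the split point adds at most 1. *)
Lemma ntri_bound (T : seq (seq nat)) (a b : nat) : noncrossing T -> a < b ->
  ntri T a b + a < b.
Proof.
move=> nc; have [n] := ubnP (b - a); elim: n a b => // n IH a b ltn ab.
have [ab1|ab1] := ltnP a.+1 b; last first.
  suff -> : ntri T a b = 0 by [].
  case: nc => _ T3 _ _; apply/eqP; rewrite -leqn0 leqNgt -has_count; apply/hasPn => t tT.
  have [sz un] := T3 _ tT; have [u [v [w [uv vw E]]]] := triangle_sorted sz un.
  by rewrite (insideE _ _ E); lia.
have [x axb H] := split_point nc ab1.
have := ntri_split nc H.
have := IH a x ltac:(lia) ltac:(lia).
have := IH x b ltac:(lia) ltac:(lia).
by case: has => /=; lia.
Qed.

(* [a, b] contains as many triangles as a noncrossing family allows. *)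
Definition full (T : seq (seq nat)) (a b : nat) : Prop := ntri T a b + a + 1 = b.

(** Equality in the bound for the whole interval forces equality for both halves and the presence of
    the triangle over the split point. *)
Lemma full_split (T : seq (seq nat)) (a b : nat) : noncrossing T -> full T a b ->
  a.+1 < b -> exists x t, [/\ a < x < b, t \in T, t =i [:: a; x; b],
    full T a x /\ full T x b & forall s, s \in T -> inside a b s ->
      [\/ inside a x s, inside x b s | s = t]].
Proof.
move=> nc fab ab; have [x axb H] := split_point nc ab.
have := ntri_split nc H.
have := @ntri_bound T a x nc ltac:(lia).
have := @ntri_bound T x b nc ltac:(lia).
rewrite /full in fab *.
case: (boolP (has _ _)) => [/hasP[t tT pt]|_]; last by rewrite /=; lia.
move=> /= ? ? ?.
have E : t =i [:: a; x; b] by move=> y; rewrite (perm_mem pt).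
exists x, t; split=> //; first by split; lia.
move=> s sT sab; case: (H s sT sab) => K; [by constructor 1|by constructor 2|].
constructor 3; case: nc => _ _ inj _; apply: inj => // y; by rewrite K E.
Qed.

(** * Pieces *)

Lemma noncrossing_sorted (T : seq (seq nat)) (t : seq nat) : noncrossing T -> t \in T ->
  exists u v w, [/\ u < v, v < w & t =i [:: u; v; w]].
Proof. by case=> _ T3 _ _ /T3[sz un]; apply: triangle_sorted. Qed.

Definition outside (p q : nat) (t : seq nat) : bool := all (fun x => (x <= p) || (q <= x)) t.

Lemma outsideE (a b u v w : nat) (t : seq nat) : t =i [:: u; v; w] ->
  outside a b t = [&& (u <= a) || (b <= u), (v <= a) || (b <= v) & (w <= a) || (b <= w)].
Proof. by move=> /eq_all_r E; rewrite /outside E /= andbT. Qed.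

(** If [s] had vertices strictly on both sides of the chord from [p] to [q], one of its sides would
    cross that chord. *)
Lemma chord_side (T : seq (seq nat)) (t s : seq nat) (p q : nat) : noncrossing T ->
  t \in T -> s \in T -> p \in t -> q \in t -> p < q -> inside p q s \/ outside p q s.
Proof.
move=> ncT tT sT pt qt pq; have [u [v [w [uv vw E]]]] := noncrossing_sorted ncT sT.
rewrite (insideE _ _ E) (outsideE _ _ E); have [us vs ws] := mem3 E.
case: ncT => _ _ _ nc.
have nts := nc _ _ tT sT p q _ _ pt qt; have nst := nc _ _ sT tT _ _ p q _ _ pt qt.
have n1 := nts _ _ us vs; have n2 := nts _ _ vs ws; have n3 := nts _ _ us ws.
have n4 := nst _ _ us vs; have n5 := nst _ _ vs ws; have n6 := nst _ _ us ws.
move: n1 n2 n3 n4 n5 n6 => /not_interleaved n1 /not_interleaved n2 /not_interleaved n3.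
move=> /not_interleaved n4 /not_interleaved n5 /not_interleaved n6.
by apply/orP; lia.
Qed.

Lemma triangle_ext (T : seq (seq nat)) (t s : seq nat) (p q r : nat) : noncrossing T ->
  t \in T -> s \in T -> t =i [:: p; q; r] -> s =i [:: p; q; r] -> s = t.
Proof. by case=> _ _ inj _ tT sT Et Es; apply: inj => // x; rewrite Et Es. Qed.

(** [chord_side] is applied to the three sides of [t]. A triangle outside both short sides and
    inside the long one can only have [p], [q], [r] as vertices. *)
Lemma triangle_gap (T : seq (seq nat)) (t s : seq nat) (p q r : nat) : noncrossing T ->
  t \in T -> s \in T -> t =i [:: p; q; r] -> p < q -> q < r ->
  [\/ s = t, inside p q s, inside q r s | outside p r s].
Proof.
move=> nc tT sT Et pq qr; have [pt qt rt] := mem3 Et.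
case: (chord_side nc tT sT pt qt pq) => [|C1]; first by constructor 2.
case: (chord_side nc tT sT qt rt qr) => [|C2]; first by constructor 3.
case: (chord_side nc tT sT pt rt ltac:(lia)) => [C3|]; last by constructor 4.
constructor 1; have [u [v [w [uv vw E]]]] := noncrossing_sorted nc sT.
apply: (triangle_ext nc tT sT Et); move: C1 C2 C3.
rewrite (insideE _ _ E) !(outsideE _ _ E) => C1 C2 C3.
by apply: (eq_seq3 E); lia.
Qed.

(* The two ways a diagonal cuts the quadrilateral p < q < r < u. *)
Definition quad (t s : seq nat) (p q r u : nat) : Prop :=
  (t =i [:: p; r; u] /\ s =i [:: p; q; r]) \/ (t =i [:: p; q; u] /\ s =i [:: q; r; u]).

(** [triangle_gap] is applied to both halves. A triangle that is at once inside and outside the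
    common diagonal would have only the two ends of the diagonal as vertices. *)
Lemma quad_gap (T : seq (seq nat)) (t1 t2 s : seq nat) (p q r u : nat) : noncrossing T ->
  t1 \in T -> t2 \in T -> s \in T -> quad t1 t2 p q r u -> p < q -> q < r -> r < u ->
  s \in [:: t1; t2] \/ [\/ inside p q s, inside q r s, inside r u s | outside p u s].
Proof.
move=> nc t1T t2T sT [] [E1 E2] pq qr ru;
  (have pr : p < r by lia); have qu : q < u by lia.
  case: (triangle_gap nc t2T sT E2 pq qr) => [->|?|?|O2].
  - by left; rewrite !inE eqxx orbT.
  - by right; constructor 1.
  - by right; constructor 2.
  case: (triangle_gap nc t1T sT E1 pr ru) => [->|I1|?|?].
  - by left; rewrite !inE eqxx.
  - have [x [y [z [xy yz E]]]] := noncrossing_sorted nc sT.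
    by move: I1 O2; rewrite (insideE _ _ E) (outsideE _ _ E); lia.
  - by right; constructor 3.
  - by right; constructor 4.
case: (triangle_gap nc t2T sT E2 qr ru) => [->|?|?|O2].
- by left; rewrite !inE eqxx orbT.
- by right; constructor 2.
- by right; constructor 3.
case: (triangle_gap nc t1T sT E1 pq qu) => [->|?|I1|?].
- by left; rewrite !inE eqxx.
- by right; constructor 1.
- have [x [y [z [xy yz E]]]] := noncrossing_sorted nc sT.
  by move: I1 O2; rewrite (insideE _ _ E) (outsideE _ _ E); lia.
- by right; constructor 4.
Qed.

(** [M] joins the two halves of each square; a triangle without partner is a piece by itself. *)
Definition pairing (T : seq (seq nat)) (M : rel (seq nat)) : Prop :=
  [/\ symmetric M, forall t s s', M t s -> M t s' -> s = s' &
      forall t s, M t s -> [/\ t \in T, s \in T & share_edge t s]].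

(** No square has one half in the interval and the other half beyond it, so the interval is filled
    by whole pieces. *)
Definition mclosed (M : rel (seq nat)) (a b : nat) : Prop :=
  forall t s, inside a b t -> M t s -> inside a b s.

(** Only [x] can be a common vertex, while an edge has two. *)
Lemma share_edge_sep (T : seq (seq nat)) (a x b : nat) (r s : seq nat) : noncrossing T ->
  r \in T -> inside a x r -> inside x b s -> share_edge r s -> False.
Proof.
case=> _ T3 _ _ /T3[_ un] /allP Ir /allP Is; rewrite /share_edge.
rewrite -size_filter => /eqP sz2.
have : size [seq y <- r | y \in s] <= size [:: x]; last by rewrite sz2.
apply: uniq_leq_size; first exact: filter_uniq.
by move=> y; rewrite mem_filter inE => /andP[/Is ys /Ir yr]; lia.
Qed.

(** This passes [mclosed] on to the halves of a split: partners share an edge, so none lies in the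
    opposite half, and only the splitting triangle [t] can be a partner outside. *)
Lemma mclosed_sub (T : seq (seq nat)) (M : rel (seq nat)) (a x b : nat) (t : seq nat) :
  noncrossing T -> pairing T M ->
  (forall s, s \in T -> inside a b s -> [\/ inside a x s, inside x b s | s = t]) ->
  forall r s, M r s -> inside a b s ->
    (inside a x r -> inside a x s \/ s = t) /\ (inside x b r -> inside x b s \/ s = t).
Proof.
move=> nc [sM _ MT] H r s Mrs sab; have [rT sT sh] := MT _ _ Mrs.
have [_ _ sh'] : [/\ s \in T, r \in T & share_edge s r] by apply: MT; rewrite sM.
split=> I; case: (H s sT sab) => J; try by [left|right].
  by case: (share_edge_sep nc rT I J sh).
by case: (share_edge_sep nc sT J I sh').
Qed.

Lemma share_edge3 (T : seq (seq nat)) (t s : seq nat) (p q r : nat) : noncrossing T ->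
  t \in T -> t =i [:: p; q; r] -> p < q -> q < r -> share_edge t s ->
  [/\ s <> t, r \notin s -> p \in s /\ q \in s & p \notin s -> q \in s /\ r \in s].
Proof.
case=> _ T3 _ _ /T3[_ un] E pq qr /eqP.
have /permP-> : perm_eq t [:: p; q; r] by apply: uniq_perm => //=; rewrite !inE; lia.
have [pt qt rt] := mem3 E; rewrite /= => sum.
split=> [st|rs|ps]; move: sum.
- by rewrite st pt qt rt.
- by rewrite (negbTE rs); case: (p \in s); case: (q \in s).
- by rewrite (negbTE ps); case: (r \in s); case: (q \in s).
Qed.

(* [lia] is slow here unless the context is reduced to its inequalities. *)
Ltac order_lia :=
  repeat match goal with
  | H : ?P |- _ => lazymatch P with
      | is_true (leq _ _) => fail
      | nat => fail
      | _ => clear H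
      end
  end; lia.

(** The piece found is the one on the chord from [a] to [b]. Its triangle [t] comes from
    [full_split]. If [t] has a partner, this lies below one of the other two sides of [t] and
    contains that side, hence is the triangle that [full_split] yields there. The gaps under the
    remaining sides are again full and filled by whole pieces. *)
Lemma root_piece (T : seq (seq nat)) (M : rel (seq nat)) (a b : nat) :
  noncrossing T -> pairing T M -> full T a b -> mclosed M a b -> a.+1 < b ->
  (exists x t, [/\ a < x < b, t \in T, (forall s, ~~ M t s), t =i [:: a; x; b] &
     [/\ full T a x, mclosed M a x, full T x b & mclosed M x b]]) \/
  (exists y x t s, [/\ a < y, y < x, x < b, M t s & quad t s a y x b] /\
     [/\ full T a y, mclosed M a y, full T y x & mclosed M y x] /\
     full T x b /\ mclosed M x b).
Proof.
move=> nc pM fab clab ab.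
have [x [t [/andP[ax xb] tT Et [fax fxb] H]]] := full_split nc fab ab.
have S := mclosed_sub nc pM H.
have [sM funM MT] := pM.
have wide c d r : inside c d r -> a <= c -> d <= b -> inside a b r.
  by move=> /allP I ac db; apply/allP => z /I; lia.
have notin c d r z : z \in r -> (z < c) || (d < z) -> ~ inside c d r.
  by move=> zr zcd /allP/(_ _ zr); lia.
have [ain xin bin] := mem3 Et.
case: (boolP (has (M t) T)) => [/hasP[s sT Mts]|/hasPn noM]; last first.
  left; exists x, t; rewrite ax xb; have un s : ~~ M t s.
    by apply/negP => Mts; have [_ sT _] := MT _ _ Mts; have := noM _ sT; rewrite Mts.
  split=> //; split=> // r s I Mrs.
    have [S1 _] := S r s Mrs (clab _ _ (wide _ _ _ I ltac:(order_lia) ltac:(order_lia)) Mrs).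
    by case: (S1 I) => // st; move: Mrs; rewrite sM st (negbTE (un _)).
  have [_ S1] := S r s Mrs (clab _ _ (wide _ _ _ I ltac:(order_lia) ltac:(order_lia)) Mrs).
  by case: (S1 I) => // st; move: Mrs; rewrite sM st (negbTE (un _)).
right; have [_ _ sh] := MT _ _ Mts.
have sab : inside a b s.
  by apply: clab Mts; rewrite (insideE _ _ Et); order_lia.
have Mst : M s t by rewrite sM.
have [st s3b s3a] := share_edge3 nc tT Et ax xb sh.
have [u [v [w [uv vw Es]]]] := noncrossing_sorted nc sT.
case: (H s sT sab) => // J.
  have bs : b \notin s by apply/negP => bs; apply: (notin _ _ _ _ bs _ J); order_lia.
  have [as_ xs] := s3b bs.
  have a1x : a.+1 < x by move: J; rewrite (insideE _ _ Es); order_lia.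
  have [y [s' [/andP[ay yx] s'T Es' [fay fyx] H']]] := full_split nc fax a1x.
  (* Since [s] contains both [a] and [x], it fits into neither half of the split of this
     interval. *)
  have ss' : s = s'.
    case: (H' s sT J) => // K; first by case: (notin _ _ _ _ xs _ K); order_lia.
    by case: (notin _ _ _ _ as_ _ K); order_lia.
  rewrite -ss' in Es' H'; have [_ yin _] := mem3 Es'.
  have S' := mclosed_sub nc pM H'.
  (* A partner could leave this interval only by being [t], whose partner is [s]. *)
  have clax r r' : inside a x r -> r <> s -> M r r' -> inside a x r'.
    move=> I rs Mrr'; have I' := wide _ _ _ I ltac:(order_lia) ltac:(order_lia).
    have [S1 _] := S _ _ Mrr' (clab _ _ I' Mrr').
    by case: (S1 I) => // r't; case: rs; apply: (funM t); rewrite // sM -r't.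
  exists y, x, t, s; split; first by split=> //; left.
  split; [split=> // r r' I Mrr' | split=> // r r' I Mrr'].
  - have rs : r <> s by move=> rs; rewrite rs in I; apply: (notin _ _ _ _ xs _ I); order_lia.
    have I' : inside a x r by apply/allP => z /(allP I); order_lia.
    have [S1 _] := S' _ _ Mrr' (clax _ _ I' rs Mrr').
    case: (S1 I) => // r's; have rt : r = t by apply: (funM s); rewrite // sM -r's.
    by rewrite rt in I; case: (notin _ _ _ _ bin _ I); order_lia.
  - have rs : r <> s by move=> rs; rewrite rs in I; apply: (notin _ _ _ _ as_ _ I); order_lia.
    have I' : inside a x r by apply/allP => z /(allP I); order_lia.
    have [_ S1] := S' _ _ Mrr' (clax _ _ I' rs Mrr').
    case: (S1 I) => // r's; have rt : r = t by apply: (funM s); rewrite // sM -r's.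
    by rewrite rt in I; case: (notin _ _ _ _ bin _ I); order_lia.
  - have [_ S1] := S r r' Mrr' (clab _ _ (wide _ _ _ I ltac:(order_lia) ltac:(order_lia)) Mrr').
    case: (S1 I) => // r't; have rs : r = s by apply: (funM t); rewrite // sM -r't.
    by rewrite rs in I; case: (notin _ _ _ _ as_ _ I); order_lia.
(* The mirror image: [s] lies over the side from [x] to [b], and the inner vertices of the
   quadrilateral are now [x < y]. *)
have as_ : a \notin s by apply/negP => as_; apply: (notin _ _ _ _ as_ _ J); order_lia.
have [xs bs] := s3a as_.
have x1b : x.+1 < b by move: J; rewrite (insideE _ _ Es); order_lia.
have [y [s' [/andP[xy yb] s'T Es' [fxy fyb] H']]] := full_split nc fxb x1b.
have ss' : s = s'.
  case: (H' s sT J) => // K; first by case: (notin _ _ _ _ bs _ K); order_lia.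
  by case: (notin _ _ _ _ xs _ K); order_lia.
rewrite -ss' in Es' H'; have [_ yin _] := mem3 Es'.
have S' := mclosed_sub nc pM H'.
have clxb r r' : inside x b r -> r <> s -> M r r' -> inside x b r'.
  move=> I rs Mrr'; have I' := wide _ _ _ I ltac:(order_lia) ltac:(order_lia).
  have [_ S1] := S _ _ Mrr' (clab _ _ I' Mrr').
  by case: (S1 I) => // r't; case: rs; apply: (funM t); rewrite // sM -r't.
exists x, y, t, s; split; first by split=> //; right.
split; [split=> // r r' I Mrr' | split=> // r r' I Mrr'].
- have [S1 _] := S r r' Mrr' (clab _ _ (wide _ _ _ I ltac:(order_lia) ltac:(order_lia)) Mrr').
  case: (S1 I) => // r't; have rs : r = s by apply: (funM t); rewrite // sM -r't.
  by rewrite rs in I; case: (notin _ _ _ _ bs _ I); order_lia.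
- have rs : r <> s by move=> rs; rewrite rs in I; apply: (notin _ _ _ _ bs _ I); order_lia.
  have I' : inside x b r by apply/allP => z /(allP I); order_lia.
  have [S1 _] := S' _ _ Mrr' (clxb _ _ I' rs Mrr').
  case: (S1 I) => // r's; have rt : r = t by apply: (funM s); rewrite // sM -r's.
  by rewrite rt in I; case: (notin _ _ _ _ ain _ I); order_lia.
- have rs : r <> s by move=> rs; rewrite rs in I; apply: (notin _ _ _ _ xs _ I); order_lia.
  have I' : inside x b r by apply/allP => z /(allP I); order_lia.
  have [_ S1] := S' _ _ Mrr' (clxb _ _ I' rs Mrr').
  case: (S1 I) => // r's; have rt : r = t by apply: (funM s); rewrite // sM -r's.
  by rewrite rt in I; case: (notin _ _ _ _ ain _ I); order_lia.
Qed.

(** * Leaves *)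

Lemma cyc_id (m i : nat) : 0 < i -> i <= m -> cyc m i = i.
Proof.
move=> i0 im; rewrite /cyc -[i]prednK // addSn -addnS prednK; last by lia.
by rewrite modnDr modn_small // prednK.
Qed.

Lemma cyc0 (m : nat) : 0 < m -> cyc m 0 = m.
Proof. by move=> m0; rewrite /cyc add0n modn_small ?prednK. Qed.

Lemma cycD (m i : nat) : 0 < m -> cyc m (i + m) = cyc m i.
Proof. by move=> m0; rewrite /cyc addnAC modnDr. Qed.

Lemma cycS (m : nat) : 0 < m -> cyc m m.+1 = 1.
Proof. by move=> m0; rewrite -add1n cycD ?cyc_id. Qed.

(** By the last clause, here and in [square_leaf], deleting the vertices that the leaf cuts off
    destroys no triangle of another piece. *)
Definition tri_leaf (m : nat) (T : seq (seq nat)) (M : rel (seq nat)) (k : nat) (t : seq nat) :=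
  [/\ 1 <= k <= m, t \in T, forall s, ~~ M t s,
      perm_eq t [:: cyc m k.-1; k; cyc m k.+1] &
      forall s, s \in T -> k \in s -> s = t].

Definition square_leaf (m : nat) (T : seq (seq nat)) (M : rel (seq nat)) (k : nat)
    (t1 t2 : seq nat) :=
  [/\ 1 <= k <= m, M t1 t2,
      perm_eq (undup (t1 ++ t2)) [:: cyc m k.-1; k; cyc m k.+1; cyc m k.+2] &
      forall s, s \in T -> (k \in s) || (cyc m k.+1 \in s) -> s \in [:: t1; t2]].

Definition leaf (m : nat) (T : seq (seq nat)) (M : rel (seq nat)) (ps : seq (seq nat)) :=
  (exists k t, ps = [:: t] /\ tri_leaf m T M k t) \/
  (exists k t1 t2, ps = [:: t1; t2] /\ square_leaf m T M k t1 t2).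

Lemma perm_tri (T : seq (seq nat)) (t : seq nat) (p q r u v w : nat) : noncrossing T ->
  t \in T -> t =i [:: p; q; r] -> [:: p; q; r] =i [:: u; v; w] -> perm_eq t [:: u; v; w].
Proof.
case=> _ T3 _ _ /T3[sz un] E F.
have EF : t =i [:: u; v; w] by move=> x; rewrite E F.
apply: uniq_perm => //; apply: (leq_size_uniq un) => [x|]; rewrite ?EF ?sz //.
Qed.

(** Two sides of [t] are sides of the polygon and [k] is their common vertex. The three cases differ
    in which side remains: the one from [p] to [r], from [q] to [r], or from [p] to [q]. *)
Lemma tri_leafI (m : nat) (T : seq (seq nat)) (M : rel (seq nat)) (t : seq nat) (p q r k : nat) :
  noncrossing T -> (forall s, s \in T -> inside 1 m s) -> t \in T ->
  (forall s, ~~ M t s) -> t =i [:: p; q; r] -> 0 < p -> p < q -> q < r -> r <= m ->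
  [\/ [/\ k = q, q = p.+1 & r = q.+1],
      [/\ k = 1, p = 1, q = 2 & r = m] |
      [/\ k = m, p = 1, q.+1 = r & r = m]] ->
  tri_leaf m T M k t.
Proof.
move=> nc Tm tT un E p0 pq qr rm K.
have km : 1 <= k <= m by case: K => -[]; lia.
split=> //.
  apply: (perm_tri nc tT E) => x; case: K => -[].
  - by move=> -> -> ->; rewrite !cyc_id ?inE; lia.
  - by move=> -> -> -> ->; rewrite cyc0 ?cyc_id ?inE; lia.
  - by move=> -> -> qm rm'; rewrite cycS ?cyc_id ?inE; lia.
move=> s sT ks; have [u [v [w [uv vw Es]]]] := noncrossing_sorted nc sT.
have := Tm s sT; move: ks; rewrite (insideE _ _ Es) Es !inE.
case: (triangle_gap nc tT sT E pq qr) => [//|||];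
  rewrite ?(insideE _ _ Es) ?(outsideE _ _ Es); case: K => -[]; lia.
Qed.

Lemma quad_mem (t s : seq nat) (p q r u : nat) : quad t s p q r u ->
  t ++ s =i [:: p; q; r; u].
Proof.
by move=> Q x; rewrite mem_cat; case: Q => -[-> ->]; rewrite !inE;
  case: (x == p); case: (x == q); case: (x == r); case: (x == u).
Qed.

(** Three sides of the quadrilateral are sides of the polygon, and [k] is the first, in cyclic
    order, of the two vertices off the fourth side. In the four cases this side joins [p] and [u],
    [p] and [q], [q] and [r], [r] and [u]. *)
Lemma square_leafI (m : nat) (T : seq (seq nat)) (M : rel (seq nat)) (t1 t2 : seq nat)
    (p q r u k : nat) :
  noncrossing T -> pairing T M -> (forall s, s \in T -> inside 1 m s) ->
  M t1 t2 -> quad t1 t2 p q r u -> 0 < p -> p < q -> q < r -> r < u -> u <= m ->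
  [\/ [/\ k = q, q = p.+1, r = q.+1 & u = r.+1],
      [/\ k = r, p = 1, r = q.+1 & u = r.+1 /\ u = m],
      [/\ k = m, p = 1, q = 2 & u = r.+1 /\ u = m] |
      [/\ k = 1, p = 1, q = 2 & r = 3 /\ u = m]] ->
  square_leaf m T M k t1 t2.
Proof.
move=> nc [_ _ MT] Tm Mt Q p0 pq qr ru um K; have [t1T t2T _] := MT _ _ Mt.
have km : 1 <= k <= m by case: K => -[? ? ?]; lia.
have c1 : cyc m m.+1 = 1 by rewrite cycS; lia.
have c2 : cyc m m.+2 = 2 by rewrite -add2n cycD ?cyc_id; lia.
have [k1 k2 k3] : [/\ cyc m k.-1 = (if k == 1 then m else k.-1),
    cyc m k.+1 = (if k == m then 1 else k.+1) &
    cyc m k.+2 = (if k == m then 2 else if k.+1 == m then 1 else k.+2)].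
  split.
  - by case: eqP => [->|?]; rewrite ?cyc0 ?cyc_id; lia.
  - by case: eqP => [->|?]; rewrite ?c1 ?cyc_id; lia.
  - case: eqP => [->|?]; first by rewrite c2.
    by case: eqP => [->|?]; rewrite ?c1 ?cyc_id; lia.
split=> //.
  apply: uniq_perm; first exact: undup_uniq.
    rewrite k1 k2 k3 /=; case: K => -[? ? ? ?]; do !case: eqP => ? //=; rewrite !inE; lia.
  move=> x; rewrite mem_undup (quad_mem Q) k1 k2 k3 !inE.
  by case: K => -[? ? ? ?]; do 2!(case: (k =P _) => ? //); do ?(case: (k.+1 =P _) => ? //); lia.
move=> s sT; have [x [y [z [xy yz Es]]]] := noncrossing_sorted nc sT.
have := Tm s sT; rewrite (insideE _ _ Es) k2 !Es.
case: (quad_gap nc t1T t2T sT Q pq qr ru) => [//|] [];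
  rewrite ?(insideE _ _ Es) ?(outsideE _ _ Es) !inE;
  clear - xy yz p0 pq qr ru um K; case: K => -[? ? ? ?]; case: (k =P m) => ?; lia.
Qed.

Lemma inside_widen (a b c d : nat) (t : seq nat) : c <= a -> b <= d ->
  inside a b t -> inside c d t.
Proof. by move=> ca bd /allP I; apply/allP => x /I; lia. Qed.

Lemma inside_sep (T : seq (seq nat)) (a b c d : nat) (t : seq nat) : noncrossing T ->
  t \in T -> b <= c -> inside a b t -> inside c d t -> False.
Proof.
move=> nc tT bc; have [u [v [w [uv vw E]]]] := noncrossing_sorted nc tT.
by rewrite !(insideE _ _ E); lia.
Qed.

(** Descend from the root piece into any gap with a vertex strictly between its ends. If there is
    none, all sides of the root piece except the chord from [a] to [b] are sides of the polygon, and
    it is a leaf itself. *)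
Lemma leaf_in (m : nat) (T : seq (seq nat)) (M : rel (seq nat)) (a b : nat) :
  noncrossing T -> pairing T M -> (forall s, s \in T -> inside 1 m s) ->
  full T a b -> mclosed M a b -> 0 < a -> a.+1 < b -> b <= m ->
  exists2 ps, leaf m T M ps & all (inside a b) ps.
Proof.
move=> nc pM Tm; have [n] := ubnP (b - a); elim: n a b => // n IH a b ltn fab cab a0 ab bm.
case: (root_piece nc pM fab cab ab) =>
  [[x [t [axb tT un E [fax cax fxb cxb]]]]|[y [x [t [s [[ay yx xb Mts Q]]]]]]].
- case: (ltnP a.+1 x) => ax.
    have [ps L I] := IH a x ltac:(lia) fax cax a0 ax ltac:(lia).
    by exists ps => //; apply: sub_all I => z; apply: inside_widen; lia.
  case: (ltnP x.+1 b) => xb.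
    have [ps L I] := IH x b ltac:(lia) fxb cxb ltac:(lia) xb bm.
    by exists ps => //; apply: sub_all I => z; apply: inside_widen; lia.
  exists [:: t]; last by rewrite /= (insideE _ _ E); lia.
  left; exists x, t; split=> //; apply: (tri_leafI nc Tm tT un E) => //; try lia.
  by constructor 1; split; lia.
case=> -[fay cay fyx cyx] [fxb cxb].
case: (ltnP a.+1 y) => ay'.
  have [ps L I] := IH a y ltac:(lia) fay cay a0 ay' ltac:(lia).
  by exists ps => //; apply: sub_all I => z; apply: inside_widen; lia.
case: (ltnP y.+1 x) => yx'.
  have [ps L I] := IH y x ltac:(lia) fyx cyx ltac:(lia) yx' ltac:(lia).
  by exists ps => //; apply: sub_all I => z; apply: inside_widen; lia.
case: (ltnP x.+1 b) => xb'.
  have [ps L I] := IH x b ltac:(lia) fxb cxb ltac:(lia) xb' bm.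
  by exists ps => //; apply: sub_all I => z; apply: inside_widen; lia.
exists [:: t; s].
  right; exists y, t, s; split=> //; apply: (square_leafI nc pM Tm Mts Q) => //.
  by constructor 1; split; lia.
by case: Q => -[Et Es]; rewrite /= (insideE _ _ Et) (insideE _ _ Es); lia.
Qed.

(** The chord from 1 to [m] is a side of the polygon, so the neighbours of the root piece all lie in
    its gaps. Two nontrivial gaps contain a leaf each ([leafs]); with exactly one, the root piece is
    the second leaf ([root_leaf]); with none, the root piece is everything. *)
Lemma two_leaves (m : nat) (T : seq (seq nat)) (M : rel (seq nat)) :
  noncrossing T -> pairing T M -> (forall s, s \in T -> inside 1 m s) ->
  full T 1 m -> 2 < m ->
  (exists2 ps, leaf m T M ps & {subset T <= ps}) \/
  (exists ps qs, [/\ leaf m T M ps, leaf m T M qs & forall t, t \in ps -> t \in qs -> False]).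
Proof.
move=> nc pM Tm f1m m2; have c1m : mclosed M 1 m.
  by move=> t s _ Mts; case: pM => _ _ MT; have [_ sT _] := MT _ _ Mts; apply: Tm.
have leafT ps t : leaf m T M ps -> t \in ps -> t \in T.
  case: pM => _ _ MT; case=> [[k [s [-> [_ sT _ _ _]]]]|[k [s1 [s2 [-> [_ Mss _ _]]]]]].
    by rewrite inE => /eqP ->.
  by have [s1T s2T _] := MT _ _ Mss; rewrite !inE => /orP[] /eqP ->.
have leafs a b c d : full T a b -> mclosed M a b -> full T c d -> mclosed M c d ->
    0 < a -> a.+1 < b -> b <= c -> c.+1 < d -> d <= m ->
    exists ps qs, [/\ leaf m T M ps, leaf m T M qs & forall t, t \in ps -> t \in qs -> False].
  move=> fab cab fcd ccd a0 ab bc cd dm.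
  have [ps Lp /allP Ip] := leaf_in nc pM Tm fab cab a0 ab ltac:(lia).
  have [qs Lq /allP Iq] := leaf_in nc pM Tm fcd ccd ltac:(lia) cd dm.
  exists ps, qs; split=> // t tp tq.
  by apply: (inside_sep nc _ bc (Ip _ tp) (Iq _ tq)); apply: leafT tp.
have root_leaf ps a b : leaf m T M ps -> (forall t, t \in ps -> ~~ inside a b t) ->
    full T a b -> mclosed M a b -> 0 < a -> a.+1 < b -> b <= m ->
    exists ps qs, [/\ leaf m T M ps, leaf m T M qs & forall t, t \in ps -> t \in qs -> False].
  move=> Lp Ip fab cab a0 ab bm.
  have [qs Lq /allP Iq] := leaf_in nc pM Tm fab cab a0 ab bm.
  by exists ps, qs; split=> // t /Ip /negP K /Iq.
case: (root_piece nc pM f1m c1m m2) =>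
  [[x [t [/andP[x1 xm] tT un E [fax cax fxb cxb]]]]|[y [x [t [s [[ay yx xm Mts Q]]]]]]].
- have tl k (K : [\/ [/\ k = x, x = 2 & m = x.+1],
      [/\ k = 1, 1 = 1, x = 2 & m = m] | [/\ k = m, 1 = 1, x.+1 = m & m = m]]) :
      leaf m T M [:: t].
    by left; exists k, t; split=> //; apply: (tri_leafI nc Tm tT un E).
  case: (ltnP 2 x) => ax; case: (ltnP x.+1 m) => xb.
  + by right; apply: (leafs 1 x x m).
  + right; apply: (root_leaf [:: t] 1 x) => //; last by lia.
      by apply: (tl m); constructor 3; split; lia.
    by move=> s; rewrite inE => /eqP ->; rewrite (insideE _ _ E); lia.
  + right; apply: (root_leaf [:: t] x m) => //; last by lia.
      by apply: (tl 1); constructor 2; split; lia.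
    by move=> s; rewrite inE => /eqP ->; rewrite (insideE _ _ E); lia.
  + left; exists [:: t]; first by apply: (tl x); constructor 1; split; lia.
    move=> s sT; rewrite inE; apply/eqP.
    have [u [v [w [uv vw Es]]]] := noncrossing_sorted nc sT.
    have := Tm s sT; rewrite (insideE _ _ Es).
    by case: (triangle_gap nc tT sT E x1 xm) => //;
      rewrite ?(insideE _ _ Es) ?(outsideE _ _ Es); lia.
case=> -[fay cay fyx cyx] [fxb cxb].
have sl k (K : [\/ [/\ k = y, y = 2, x = y.+1 & m = x.+1],
      [/\ k = x, 1 = 1, x = y.+1 & m = x.+1 /\ m = m],
      [/\ k = m, 1 = 1, y = 2 & m = x.+1 /\ m = m] |
      [/\ k = 1, 1 = 1, y = 2 & x = 3 /\ m = m]]) : leaf m T M [:: t; s].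
  by right; exists k, t, s; split=> //; apply: (square_leafI nc pM Tm Mts Q).
have notin a b : (1 < a /\ x <= a) \/ (b < m /\ b <= y) \/ (1 < a /\ b < m) ->
    forall r, r \in [:: t; s] -> ~~ inside a b r.
  move=> K r; rewrite !inE; case: Q => -[Et Es] /orP[] /eqP ->;
    rewrite ?(insideE _ _ Et) ?(insideE _ _ Es); lia.
case: (ltnP 2 y) => ay'; case: (ltnP y.+1 x) => yx'; case: (ltnP x.+1 m) => xb'.
- by right; apply: (leafs 1 y y x) => //; lia.
- by right; apply: (leafs 1 y y x) => //; lia.
- by right; apply: (leafs 1 y x m) => //; lia.
- right; apply: (root_leaf [:: t; s] 1 y) => //; try lia.
    by apply: (sl x); constructor 2; split; lia.
  by apply: notin; lia.
- by right; apply: (leafs y x x m) => //; lia.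
- right; apply: (root_leaf [:: t; s] y x) => //; try lia.
    by apply: (sl m); constructor 3; split; lia.
  by apply: notin; lia.
- right; apply: (root_leaf [:: t; s] x m) => //; try lia.
    by apply: (sl 1); constructor 4; split; lia.
  by apply: notin; lia.
left; exists [:: t; s]; first by apply: (sl y); constructor 1; split; lia.
move=> r rT; have [u [v [w [uv vw Er]]]] := noncrossing_sorted nc rT.
have [_ _ MT] := pM; have [tT sT _] := MT _ _ Mts.
have := Tm r rT; rewrite (insideE _ _ Er).
by case: (quad_gap nc tT sT rT Q ay yx xm) => [//|] [];
  rewrite ?(insideE _ _ Er) ?(outsideE _ _ Er); lia.
Qed.

(** * Removing vertices from a triangulation *)

Lemma index_lt_sorted (P : seq nat) (a b : nat) : sorted ltn P -> a \in P -> b \in P ->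
  (index a P < index b P) = (a < b).
Proof.
move=> so aP bP; have mono := sorted_ltn_index ltn_trans so.
case: (ssrnat.ltngtP (index a P)) => [ab|ba|ab].
- by rewrite (mono _ _ aP bP ab).
- by apply/esym/negbTE; rewrite -leqNgt; apply/ltnW/mono.
- by rewrite -(nth_index 0 aP) ab nth_index // ltnn.
Qed.

Lemma between_sorted (P : seq nat) (a b x : nat) : sorted ltn P ->
  a \in P -> b \in P -> x \in P -> between P a b x = (minn a b < x < maxn a b).
Proof.
move=> so aP bP xP; rewrite /between !gtn_min !leq_max.
by rewrite !(index_lt_sorted so).
Qed.

(** The right-hand side does not mention [P], so crossing is unaffected by the deletion of other
    vertices. *)
Lemma crossing_sorted (P : seq nat) (a b c d : nat) : sorted ltn P ->
  a \in P -> b \in P -> c \in P -> d \in P -> crossing P a b c d =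
  uniq [:: a; b; c; d] && ((minn a b < c < maxn a b) != (minn a b < d < maxn a b)).
Proof. by move=> so aP bP cP dP; rewrite /crossing !between_sorted. Qed.

Lemma pairwise_mem (T : eqType) (r : rel T) (s : seq T) (x y : T) :
  pairwise r s -> x \in s -> y \in s -> [\/ x = y, r x y | r y x].
Proof.
elim: s => //= z s IH /andP[/allP az ps]; rewrite !inE.
move=> /orP[/eqP->|xs] /orP[/eqP->|ys].
- by constructor 1.
- by constructor 2; apply: az.
- by constructor 3; apply: az.
- exact: IH.
Qed.

Lemma triangulation_noncrossing (P : seq nat) (T : seq (seq nat)) : sorted ltn P ->
  triangulation P T -> noncrossing T.
Proof.
move=> so [unP _ /allP tri _ pw].
have tri3 t : t \in T -> [/\ size t = 3, uniq t & {subset t <= P}].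
  by move=> /tri /and3P[/eqP sz un /allP sub].
split=> [|t /tri3[]//|t s tT sT E|t s tT sT a b c d at_ bt cs ds [ac cb bd]].
- by apply: pairwise_uniq pw => t /=; rewrite perm_refl.
- have [_ ut _] := tri3 _ tT; have [_ us _] := tri3 _ sT.
  case: (pairwise_mem pw tT sT) => // /andP[/negP[]].
    exact: uniq_perm.
  by apply: uniq_perm => // x; rewrite E.
have [st ut tP] := tri3 _ tT; have [_ us sP] := tri3 _ sT.
case: (pairwise_mem pw tT sT) => [ts|/andP[_]|/andP[_]].
- rewrite -ts in cs ds.
  have : size [:: a; b; c; d] <= size t; last by rewrite st.
  apply: uniq_leq_size; first by rewrite /= !inE; clear - ac cb bd; lia.
  by move=> x; rewrite !inE => /or4P[] /eqP ->.
- move=> /allP/(_ _ at_)/allP/(_ _ bt)/allP/(_ _ cs)/allP/(_ _ ds).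
  rewrite crossing_sorted ?(tP a) ?(tP b) ?(sP c) ?(sP d) //= !inE; clear - ac cb bd; lia.
- move=> /allP/(_ _ cs)/allP/(_ _ ds)/allP/(_ _ at_)/allP/(_ _ bt).
  rewrite crossing_sorted ?(tP a) ?(tP b) ?(sP c) ?(sP d) //= !inE; clear - ac cb bd; lia.
Qed.

Lemma size_filter_notin (T : eqType) (s ts : seq T) : uniq s -> uniq ts ->
  {subset ts <= s} -> size [seq x <- s | x \notin ts] + size ts = size s.
Proof.
move=> us uts sub; rewrite -(count_predC (mem ts) s) addnC size_filter; congr (_ + _).
rewrite -size_filter; apply/perm_size/uniq_perm => //; first exact: filter_uniq.
by move=> x; rewrite mem_filter /=; case: (boolP (x \in ts)) => // /sub ->.
Qed.

(** As many triangles as vertices disappear, which keeps the count [size P - 2], and by the last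
    hypothesis the surviving triangles use surviving vertices only. *)
Lemma triangulation_del (P vs : seq nat) (T ts : seq (seq nat)) : sorted ltn P ->
  triangulation P T -> uniq vs -> {subset vs <= P} -> uniq ts -> {subset ts <= T} ->
  size vs = size ts -> (forall t v, t \in T -> v \in vs -> v \in t -> t \in ts) ->
  triangulation (del_vertices vs P) [seq t <- T | t \notin ts].
Proof.
move=> so trT uvs svs uts sts sz far.
have [uT _ _ _] := triangulation_noncrossing so trT.
have [uP P2 /allP tri sT pw] := trT.
have szP : size (del_vertices vs P) + size vs = size P.
  exact: size_filter_notin.
have szT : size ([seq t <- T | t \notin ts] : seq (seq nat)) + size (ts : seq (seq nat))
    = size (T : seq (seq nat)).
  exact: size_filter_notin.
have subP t : t \in [seq t <- T | t \notin ts] -> {subset t <= del_vertices vs P}.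
  rewrite mem_filter => /andP[tts tT] x xt; have /and3P[_ _ /allP sub] := tri _ tT.
  rewrite mem_filter sub // andbT; apply: contra tts => xvs; exact: far tT xvs xt.
have so' : sorted ltn (del_vertices vs P) by apply: sorted_filter => //; apply: ltn_trans.
split.
- exact: filter_uniq.
(* At most [size P - 2] triangles, hence as many vertices, are removed, so two vertices survive. *)
- by clear - szP szT sz sT P2; lia.
- apply/allP => t tT'; have := tT'; rewrite mem_filter => /andP[_ /tri /and3P[s3 ut _]].
  by apply/and3P; split=> //; apply/allP; apply: subP.
- by clear - szP szT sz sT P2; lia.
have memP x : x \in del_vertices vs P -> x \in P by rewrite mem_filter => /andP[].
have := pairwise_filter (fun t => t \notin ts) pw.
apply: (sub_in_pairwise (P := [in [seq t <- T | t \notin ts]])); last exact/allP.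
move=> t s /subP tP /subP sP /andP[-> /allP H] /=.
apply/allP => a at_; apply/allP => b bt; apply/allP => c cs; apply/allP => d ds.
have := allP (allP (allP (H a at_) b bt) c cs) d ds.
have [a' b' c' d'] := And4 (tP a at_) (tP b bt) (sP c cs) (sP d ds).
by rewrite !crossing_sorted //; apply: memP.
Qed.

(** * Admissible labellings *)

Definition units : seq int := [:: 1%R; (-1)%R].

Lemma units_opp (c : int) : ((- c)%R \in units) = (c \in units).
Proof. by rewrite !inE; lia. Qed.

(* The squares of an admissible labelling, as a relation between triangles. *)
Definition matching (L : lab_tri) (M : rel (seq nat)) : Prop :=
  [/\ symmetric M, forall t s s', M t s -> M t s' -> s = s',
      forall t s, M t s -> share_edge t s /\
        exists c, [/\ c \notin units, (t, c) \in L & (s, (- c)%R) \in L] &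
      forall t c, (t, c) \in L -> c \notin units -> exists s, M t s].

Lemma label_uniq (L : lab_tri) (t : seq nat) (c c' : int) : uniq (map fst L) ->
  (t, c) \in L -> (t, c') \in L -> c = c'.
Proof.
elim: L => //= -[s d] L IH /andP[/= sL uL]; rewrite !inE.
have H e : (t, e) \in L -> t != s.
  by move=> K; apply: contra sL => /eqP <-; apply/mapP; exists (t, e).
move=> /orP[/eqP[ts ->]|tc] /orP[/eqP[ts' ->]|tc'] //.
- by have := H _ tc'; rewrite ts eqxx.
- by have := H _ tc; rewrite ts' eqxx.
- exact: IH.
Qed.

Lemma ltri_inj (L : lab_tri) : uniq (map fst L) ->
  injective (fun i : 'I_(size L) => ltri L i).
Proof.
move=> uL i j; rewrite /ltri -!(nth_map _ [::]) // => /eqP.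
by rewrite nth_uniq ?size_map // => /eqP /val_inj.
Qed.

Lemma mem_ltri (L : lab_tri) (i : 'I_(size L)) : (ltri L i, llab L i) \in L.
Proof. by rewrite /ltri /llab -surjective_pairing mem_nth. Qed.

Lemma ltriP (L : lab_tri) (t : seq nat) (c : int) : (t, c) \in L ->
  exists i : 'I_(size L), ltri L i = t /\ llab L i = c.
Proof.
move=> tc; have lt : index (t, c) L < size L by rewrite index_mem.
by exists (Ordinal lt); rewrite /ltri /llab /= nth_index.
Qed.

(** Partners are the two members of a block. Triangles are distinct, so they can replace positions
    in [L]; blocks are disjoint of size two, so partners are unique. *)
Lemma partition_matching (L : lab_tri) (Q : {set {set 'I_(size L)}}) : uniq (map fst L) ->
  partition Q [set i : 'I_(size L) | llab L i \notin [:: 1%R; (-1)%R]] ->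
  (forall B, B \in Q -> #|B| = 2 /\ forall i j, i \in B -> j \in B -> i != j ->
     share_edge (ltri L i) (ltri L j) /\ llab L i = (- llab L j)%R) ->
  exists M, matching L M.
Proof.
move=> uL /and3P[/eqP cov tI _] HB.
pose M (t s : seq nat) := [exists i : 'I_(size L), exists j : 'I_(size L),
  [&& ltri L i == t, ltri L j == s, i != j & [exists B in Q, (i \in B) && (j \in B)]]].
have MP t s : reflect (exists (i j : 'I_(size L)) (B : {set 'I_(size L)}),
  [/\ ltri L i = t, ltri L j = s, i != j, B \in Q &
    i \in B /\ j \in B]) (M t s).
  apply: (iffP existsP) => [[i /existsP[j /and4P[/eqP it /eqP js ij]]]|[i [j [B]]]].
    by case/existsP=> B /and3P[BQ iB jB]; exists i, j, B.
  case=> it js ij BQ [iB jB]; exists i; apply/existsP; exists j.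
  by rewrite it js !eqxx ij; apply/existsP; exists B; rewrite BQ iB.
exists M; split.
- by move=> t s; apply/MP/MP => -[i [j [B [it js ij BQ [iB jB]]]]];
    exists j, i, B; rewrite eq_sym.
- move=> t s s' /MP[i [j [B [it js ij BQ [iB jB]]]]].
  move=> /MP[i' [j' [B' [it' js' ij' BQ' [iB' jB']]]]].
  have ii' : i' = i by apply: (ltri_inj uL); rewrite it it'.
  rewrite ii' in ij' iB'.
  have BB' : B' = B by rewrite -(def_pblock tI BQ' iB') (def_pblock tI BQ iB).
  rewrite BB' in jB'; have [c2 _] := HB _ BQ.
  have /card_le1_eqP c1 : #|B :\ i| <= 1 by move: c2; rewrite (cardsD1 i) iB add1n => -[->].
  by rewrite -js -js' (c1 j j') // !inE eq_sym ?ij ?ij'.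
- move=> t s /MP[i [j [B [<- <- ij BQ [iB jB]]]]].
  have [_ /(_ i j iB jB ij)[sh lab]] := HB _ BQ; split=> //.
  exists (llab L i); split; try exact: mem_ltri.
    by have : i \in cover Q; [apply/bigcupP; exists B | rewrite cov inE].
  by rewrite lab opprK mem_ltri.
- move=> t c /ltriP[i [<- <-]] ci.
  have iQ : i \in cover Q by rewrite cov inE.
  have iB : i \in pblock Q i by rewrite mem_pblock.
  have BQ := pblock_mem iQ; have [c2 _] := HB _ BQ.
  have /card_gt0P[j] : 0 < #|pblock Q i :\ i| by move: c2; rewrite (cardsD1 i) iB add1n => -[->].
  rewrite !inE => /andP[ji jB]; exists (ltri L j); apply/MP.
  by exists i, j, (pblock Q i); rewrite eq_sym.
Qed.

(** The way back, for the labelling that is left after a removal. Uniqueness of partners makes the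
    reflexive closure [R] of [M] an equivalence, and its classes are the blocks. *)
Lemma matching_partition (L : lab_tri) (M : rel (seq nat)) : uniq (map fst L) ->
  (forall t, t \in map fst L -> size t = 3) -> matching L M ->
  exists Q : {set {set 'I_(size L)}},
    partition Q [set i : 'I_(size L) | llab L i \notin [:: 1%R; (-1)%R]] /\
    forall B, B \in Q -> #|B| = 2 /\ forall i j, i \in B -> j \in B -> i != j ->
      share_edge (ltri L i) (ltri L j) /\ llab L i = (- llab L j)%R.
Proof.
move=> uL s3 [sM fM ML exM].
pose D := [set i : 'I_(size L) | llab L i \notin units].
pose R (i j : 'I_(size L)) := (i == j) || M (ltri L i) (ltri L j).
have inj := ltri_inj uL.
have RM i j k : R i j -> R i k -> j != k -> M (ltri L j) (ltri L k).
  move=> /orP[/eqP <-|Mij] /orP[/eqP <-|Mik]; rewrite ?eqxx // => jk.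
    by rewrite sM.
  by have E := fM _ _ _ Mij Mik; rewrite (inj _ _ E) eqxx in jk.
have Rsym i j : R i j -> R j i by rewrite /R eq_sym sM.
have Rtr i j k : R i j -> R i k -> R j k.
  by move=> Rij Rik; rewrite /R; case: eqP => //= /eqP; apply: RM Rij Rik.
exists (equivalence_partition R D); split.
  apply: equivalence_partitionP => i j k _ _ _; split=> [|Rij].
    by rewrite /R eqxx.
  by apply/idP/idP; [apply: Rtr Rij | apply: Rtr (Rsym _ _ Rij)].
move=> B /imsetP[i iD ->].
have [s Ms] : exists s, M (ltri L i) s.
  by apply: exM (mem_ltri i) _; move: iD; rewrite inE.
have [sh [c [cu tc sc]]] := ML _ _ Ms.
have [j [js jc]] := ltriP sc; rewrite -js in Ms.
(* A triangle has three vertices in common with itself, whereas [share_edge] demands exactly two. *)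
have ij : i != j.
  apply/eqP => ij; move: sh; rewrite -js -ij /share_edge => /eqP c2.
  have s3i : size (ltri L i) = 3.
    by apply: s3; apply/mapP; exists (ltri L i, llab L i); rewrite ?mem_ltri.
  have := all_count (fun x => x \in ltri L i) (ltri L i); rewrite c2 s3i /= => /negbT/negP.
  by apply; apply/allP.
split.
  rewrite (_ : [set _ in _ | _] = [set i; j]) ?cards2 ?ij //.
  apply/setP => k; rewrite !inE /R; apply/idP/idP.
    move=> /andP[_ /orP[/eqP ->|Mik]]; first by rewrite eqxx.
    by rewrite (inj _ _ (fM _ _ _ Mik Ms)) eqxx orbT.
  move=> /orP[/eqP ->|/eqP ->]; first by rewrite eqxx; move: iD; rewrite !inE => ->.
  by rewrite Ms orbT andbT; move: cu; rewrite -units_opp -jc !inE.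
move=> k l; rewrite !inE => /andP[_ Rik] /andP[_ Ril] kl.
have [sh' [e [_ ke le]]] := ML _ _ (RM _ _ _ Rik Ril kl); split=> //.
rewrite (label_uniq uL (mem_ltri k) ke) -(label_uniq uL le (mem_ltri l)) opprK //.
Qed.

Lemma matching_neg (L : lab_tri) (M : rel (seq nat)) :
  matching L M -> matching (neg_labels L) M.
Proof.
case=> sM fM ML exM.
have memN t c : ((t, c) \in neg_labels L) = ((t, (- c)%R) \in L).
  apply/mapP/idP => [[[s d] sd [-> ->]]|tc]; first by rewrite opprK.
  by exists (t, (- c)%R); rewrite /= ?opprK.
split=> // [t s Mts|t c].
  have [sh [c [cu tc sc]]] := ML _ _ Mts; split=> //.
  by exists (- c)%R; rewrite units_opp !memN !opprK.
by rewrite memN -units_opp; apply: exM.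
Qed.

Lemma matching_del (L : lab_tri) (M : rel (seq nat)) (ts : seq (seq nat)) :
  matching L M -> (forall t s, t \in ts -> M t s -> s \in ts) ->
  matching (del_tris ts L) (fun t s => M t s && (t \notin ts)).
Proof.
case=> sM fM ML exM clts.
have clts' t s : M t s -> (t \in ts) = (s \in ts).
  by move=> Mts; apply/idP/idP => /clts; apply; rewrite // sM.
split.
- by move=> t s; rewrite sM; case: (boolP (M s t)) => //= /clts' ->.
- by move=> t s s' /andP[Mts _] /andP[Mts' _]; apply: fM Mts Mts'.
- move=> t s /andP[Mts tts]; have [sh [c [cu tc sc]]] := ML _ _ Mts; split=> //.
  by exists c; rewrite !mem_filter /= -(clts' _ _ Mts) tts.
- move=> t c; rewrite mem_filter /= => /andP[tts tc] cu.
  by have [s Mts] := exM _ _ tc cu; exists s; rewrite Mts.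
Qed.

(* This is 2d, so that d is an even integer iff 4 divides it. *)
Definition weight (L : lab_tri) : nat :=
  2 * count (fun p : seq nat * int => (p.2 < 0)%R) L
    + count (fun p : seq nat * int => p.2 == 0%R) L.

Lemma weight_cat (L L' : lab_tri) : weight (L ++ L') = weight L + weight L'.
Proof. by rewrite /weight !count_cat; lia. Qed.

Lemma weight_perm (L L' : lab_tri) : perm_eq L L' -> weight L = weight L'.
Proof. by move=> /permP E; rewrite /weight !E. Qed.

(* Each label contributes 2 to the sum, since negation swaps the signs. *)
Lemma weight_neg (L : lab_tri) : weight (neg_labels L) + weight L = 2 * size L.
Proof.
elim: L => // -[t c] L; rewrite /weight /= oppr_lt0 oppr_eq0.
by case: (ltrgtP c 0%R) => /=; lia.
Qed.

(** Either exactly one of the two labels is negative and none is 0, or both are 0. *)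
Lemma weight_square (t s : seq nat) (c : int) : weight [:: (t, c); (s, (- c)%R)] = 2.
Proof.
rewrite /weight /= oppr_lt0 oppr_eq0.
by case: (ltrgtP c 0%R) => /=; lia.
Qed.

(** A triangle determines its label, so deleting by triangle removes exactly the entries of [K]. *)
Lemma perm_del_tris (L K : lab_tri) : uniq (map fst L) -> uniq K -> {subset K <= L} ->
  perm_eq L (K ++ del_tris (map fst K) L).
Proof.
move=> uL uK sKL.
rewrite -(perm_filterC (fun p : seq nat * int => p.1 \in map fst K) L) perm_cat2r.
apply: uniq_perm => //; first exact: (filter_uniq _ (map_uniq uL)).
move=> [t c]; rewrite mem_filter /=; apply/andP/idP => [[/mapP[[s d] sdK /= ts] tcL]|tcK];
  last by split; [apply/mapP; exists (t, c) | apply: sKL].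
by rewrite ts in tcL *; rewrite (label_uniq uL tcL (sKL _ sdK)).
Qed.

(** * Removing leaves from a labelled triangulation *)

Definition removable (m : nat) (T : seq (seq nat)) (M : rel (seq nat))
    (vs : seq nat) (ts : seq (seq nat)) : Prop :=
  [/\ [/\ uniq vs, {subset vs <= iota 1 m}, uniq ts & {subset ts <= T}], size vs = size ts,
      forall t s, t \in ts -> M t s -> s \in ts,
      forall t v, t \in T -> v \in vs -> v \in t -> t \in ts &
      forall v, v \in vs -> exists2 t, t \in ts & v \in t].

(** Disjointness of the triangles yields that of the vertices: by the last clause of [removable] a
    common vertex lies on a triangle of [ts], which then belongs to [ts'] too. *)
Lemma removable_cat (m : nat) (T : seq (seq nat)) (M : rel (seq nat))
    (vs vs' : seq nat) (ts ts' : seq (seq nat)) :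
  removable m T M vs ts -> removable m T M vs' ts' ->
  (forall t, t \in ts -> t \in ts' -> False) -> removable m T M (vs ++ vs') (ts ++ ts').
Proof.
move=> [[uv sv ut st] sz cl far ne] [[uv' sv' ut' st'] sz' cl' far' ne'] dis.
split; [split | by rewrite !size_cat sz sz' | | |].
- rewrite cat_uniq uv uv' andbT; apply/hasPn => v vvs' /=; apply/negP => vvs.
  have [t tts vt] := ne _ vvs.
  exact: dis tts (far' _ _ (st _ tts) vvs' vt).
- by move=> v; rewrite mem_cat => /orP[/sv|/sv'].
- rewrite cat_uniq ut ut' andbT; apply/hasPn => t tts' /=; apply/negP => tts.
  exact: dis tts tts'.
- by move=> t; rewrite mem_cat => /orP[/st|/st'].
- move=> t s; rewrite !mem_cat => /orP[tts|tts'] Mts; first by rewrite (cl _ _ tts Mts).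
  by rewrite (cl' _ _ tts' Mts) orbT.
- move=> t v tT; rewrite !mem_cat => /orP[vvs|vvs'] vt.
    by rewrite (far _ _ tT vvs vt).
  by rewrite (far' _ _ tT vvs' vt) orbT.
- move=> v; rewrite mem_cat => /orP[/ne|/ne'] [t tts vt]; exists t => //.
    by rewrite mem_cat tts.
  by rewrite mem_cat tts orbT.
Qed.

Lemma mem_cyc (m i : nat) : 0 < m -> cyc m i \in iota 1 m.
Proof. by move=> m0; rewrite mem_iota /cyc add1n !ltnS ltn_mod. Qed.

Lemma removable_tri (m : nat) (T : seq (seq nat)) (M : rel (seq nat)) (k : nat) (t : seq nat) :
  tri_leaf m T M k t -> removable m T M [:: k] [:: t].
Proof.
move=> [km tT un /perm_mem E far]; split=> //.
- split=> // [v|s]; rewrite inE => /eqP -> //.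
  by rewrite mem_iota; lia.
- by move=> r s; rewrite inE => /eqP ->; rewrite (negbTE (un s)).
- by move=> s v sT; rewrite inE => /eqP -> /(far _ sT) ->; rewrite inE.
- by move=> v; rewrite inE => /eqP ->; exists t; rewrite ?E !inE eqxx ?orbT.
Qed.

Lemma removable_square (m : nat) (T : seq (seq nat)) (M : rel (seq nat)) (k : nat)
    (t1 t2 : seq nat) : noncrossing T -> pairing T M ->
  square_leaf m T M k t1 t2 -> removable m T M [:: k; cyc m k.+1] [:: t1; t2].
Proof.
move=> nc [sM fM MT] [km Mt E far]; have [t1T t2T sh] := MT _ _ Mt.
have mE := perm_mem E.
(* Transported along [E], this makes the four vertices distinct, in particular [k] and its cyclic
   successor. *)
have : uniq (undup (t1 ++ t2)) by apply: undup_uniq.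
rewrite (perm_uniq E) /= => /and4P[_ k1 _ _].
split=> //.
- split.
  + by rewrite /= andbT; apply: contra k1; rewrite !inE => ->.
  + move=> v; rewrite !inE => /orP[] /eqP ->; last by apply: mem_cyc; lia.
    by rewrite mem_iota; lia.
  + rewrite /= inE andbT; apply/eqP => t12; rewrite -t12 in sh.
    have [_ T3 _ _] := nc; have [sz un] := T3 _ t1T.
    move: sh; rewrite /share_edge => /eqP c2.
    have := all_count (fun x => x \in t1) t1; rewrite c2 sz /= => /negbT/negP.
    by apply; apply/allP.
  + by move=> s; rewrite !inE => /orP[] /eqP ->.
- move=> t s; rewrite !inE => /orP[] /eqP -> Ms.
    by rewrite (fM _ _ _ Ms Mt) eqxx orbT.
  by rewrite (fM _ _ t1 Ms) ?eqxx // sM.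
- move=> s v sT; rewrite !inE => /orP[] /eqP -> vs; have := far _ sT;
    by rewrite vs ?orbT !inE; apply.
- move=> v vvs; have : v \in undup (t1 ++ t2).
    by rewrite mE; move: vvs; rewrite !inE => /orP[] /eqP ->; rewrite eqxx ?orbT.
  by rewrite mem_undup mem_cat => /orP[]; [exists t1 | exists t2]; rewrite // !inE eqxx ?orbT.
Qed.

Lemma leaf_tri_unit (L : lab_tri) (M : rel (seq nat)) (t : seq nat) : matching L M ->
  t \in map fst L -> (forall s, ~~ M t s) -> (t, 1%R) \in L \/ (t, (-1)%R) \in L.
Proof.
move=> [_ _ _ exM] /mapP[[s c] sc /= ->] un.
case: (boolP (c \in units)) => [|/(exM _ _ sc)[r]]; last by rewrite (negbTE (un r)).
by rewrite !inE => /orP[] /eqP <-; [left | right].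
Qed.

(** The remaining weight is [weight L - weight K], and after negation it is [2 * (m - 2 - size K) -
    (weight L - weight K)]. As 4 divides [weight L], each hypothesis on [K] says that the new weight
    is divisible by 4. *)
Lemma adm_del (m : nat) (L K : lab_tri) (M : rel (seq nat)) (vs : seq nat) :
  triangulation (iota 1 m) (map fst L) -> matching L M -> uniq K -> {subset K <= L} ->
  removable m (map fst L) M vs (map fst K) -> 4 %| weight L ->
  (4 %| weight K -> adm_triangulation (del_vertices vs (iota 1 m)) (del_tris (map fst K) L)) /\
  (4 %| 2 * (m - 2 - size K) + weight K ->
    adm_triangulation (del_vertices vs (iota 1 m)) (neg_labels (del_tris (map fst K) L))).
Proof.
move=> tri match_ uK sKL [[uv sv ut st] sz cl far _] w4.
have so : sorted ltn (iota 1 m) by apply: iota_ltn_sorted.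
have [uL T3 _ _] := triangulation_noncrossing so tri.
have tri' := triangulation_del so tri uv sv ut st sz far.
have mapD : map fst (del_tris (map fst K) L) = [seq t <- map fst L | t \notin map fst K].
  by rewrite filter_map.
have mapN L' : map fst (neg_labels L') = map fst L' by rewrite -map_comp; apply: eq_map.
have match' := matching_del match_ cl.
have uL' : uniq (map fst (del_tris (map fst K) L)) by rewrite mapD filter_uniq.
have T3' t : t \in map fst (del_tris (map fst K) L) -> size t = 3.
  by rewrite mapD mem_filter => /andP[_ /T3[]].
have permL := perm_del_tris uL uK sKL.
have wL := weight_perm permL; rewrite weight_cat in wL.
have szL : size L = m - 2 by case: tri => _ _ _; rewrite size_map size_iota.
have szD := perm_size permL; rewrite size_cat szL in szD.
have wN := weight_neg (del_tris (map fst K) L); rewrite (_ : size _ = m - 2 - size K) in wN.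
  2: by rewrite szD addKn.
split=> d4; (split; first by rewrite ?mapN mapD).
- split; first exact: matching_partition match'.
  clear - d4 w4 wL; suff /dvdnP[e E] : 4 %| weight (del_tris (map fst K) L).
    by exists e; rewrite [RHS]mulnC -E.
  by lia.
- split; first by apply: matching_partition (matching_neg match'); rewrite mapN.
  suff /dvdnP[e E] : 4 %| weight (neg_labels (del_tris (map fst K) L)).
    by exists e; rewrite [RHS]mulnC -E.
  by move: d4; rewrite -wN; clear - w4 wL; lia.
Qed.

(** * Choosing the case from the parity of [m] and the kinds of the leaves *)

Theorem theorem7p6 (m : nat) (L : lab_tri) :
  (2 <= m)%N -> triangulation (iota 1 m) (map fst L) -> admissible L ->
  (* (0) *)
  ((m < 4)%N /\ (L = [::] \/ exists t, L = [:: (t, 1%R)]))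
  \/
  (* (1) *)
  (exists k t, [/\ (1 <= k <= m)%N, ear m L k 1%R t &
     adm_triangulation (del_vertices [:: k] (iota 1 m)) (del_tris [:: t] L)])
  \/
  (* (2) *)
  (odd m /\ exists k t1 t2, [/\ (1 <= k <= m)%N, square m L k t1 t2 &
     adm_triangulation (del_vertices [:: k; cyc m k.+1] (iota 1 m))
                       (neg_labels (del_tris [:: t1; t2] L))])
  \/
  (* (3) *)
  (~~ odd m /\ exists k t, [/\ (1 <= k <= m)%N, ear m L k (-1)%R t &
     adm_triangulation (del_vertices [:: k] (iota 1 m))
                       (neg_labels (del_tris [:: t] L))])
  \/
  (* (4) *)
  (exists j k t1 t2 t3 t4,
     [/\ [&& (1 <= j <= m)%N, (1 <= k <= m)%N & (j.+1 < k)%N || (k.+1 < j)%N],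
         square m L j t1 t2, square m L k t3 t4 &
     adm_triangulation (del_vertices [:: j; cyc m j.+1; k; cyc m k.+1] (iota 1 m))
                       (del_tris [:: t1; t2; t3; t4] L)])
  \/
  (* (5) *)
  (exists j k t1 t2,
     [/\ [&& (1 <= j <= m)%N, (1 <= k <= m)%N & (j.+1 < k)%N || (k.+1 < j)%N],
         ear m L j (-1)%R t1, ear m L k (-1)%R t2 &
     adm_triangulation (del_vertices [:: j; k] (iota 1 m))
                       (del_tris [:: t1; t2] L)]).
Proof.
move=> m2 tri [[Q [pQ HQ]] [e We]].
have szL : size L = m - 2 by case: tri => _ _ _; rewrite size_map size_iota.
have w4 : 4 %| weight L by rewrite /weight We dvdn_mulr.
(* Only [m = 2] is settled by (0) here; a single triangle labelled 1 is an ear and is found below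
   under (1). *)
have [m3|m3] := ltnP 2 m; last first.
  left; split; first by apply: leq_ltn_trans m3 _.
  by left; apply: size0nil; rewrite szL; apply/eqP.
have so : sorted ltn (iota 1 m) by apply: iota_ltn_sorted.
have nc := triangulation_noncrossing so tri; have [uL T3 _ _] := nc.
have [M match_] := partition_matching uL pQ HQ.
have [sM fM ML exM] := match_.
have pM : pairing (map fst L) M.
  split=> // t s Mts; have [sh [c [_ tc sc]]] := ML _ _ Mts.
  by split=> //; apply/mapP; [exists (t, c) | exists (s, (- c)%R)].
have Tm s : s \in map fst L -> inside 1 m s.
  case: tri => _ _ /allP tri _ _ /tri /and3P[_ _ /allP sub].
  by apply/allP => x /sub; rewrite mem_iota add1n ltnS.
have f1m : full (map fst L) 1 m.
  rewrite /full /ntri; have /allP := Tm; rewrite all_count => /eqP ->.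
  by rewrite size_map szL -addnA subnK.
have tri_cases k t : tri_leaf m (map fst L) M k t ->
    (exists k t, [/\ (1 <= k <= m)%N, ear m L k 1%R t &
     adm_triangulation (del_vertices [:: k] (iota 1 m)) (del_tris [:: t] L)]) \/
    ear m L k (-1)%R t /\ (~~ odd m -> exists k t, [/\ (1 <= k <= m)%N, ear m L k (-1)%R t &
     adm_triangulation (del_vertices [:: k] (iota 1 m)) (neg_labels (del_tris [:: t] L))]).
  move=> tl; have rem := removable_tri tl; have [km tT un E _] := tl.
  have one c : (t, c) \in L -> {subset [:: (t, c)] <= L} by move=> tc x; rewrite inE => /eqP ->.
  case: (leaf_tri_unit match_ tT un) => tc.
    have [A1 _] := adm_del (K := [:: (t, 1%R)]) tri match_ isT (one _ tc) rem w4.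
    by left; exists k, t; split=> //; apply: A1.
  have [_ A2] := adm_del (K := [:: (t, (-1)%R)]) tri match_ isT (one _ tc) rem w4.
  right; split=> // om; exists k, t; split=> //; apply: A2.
  (* The triangle has weight 2, and [2 * (m - 3) + 2 = 2 * (m - 2)] is divisible by 4 for even
     [m]. *)
  by rewrite /weight /=; clear - om m3; lia.
have sq_cases k t1 t2 : square_leaf m (map fst L) M k t1 t2 ->
    square m L k t1 t2 /\ (odd m -> exists k t1 t2, [/\ (1 <= k <= m)%N, square m L k t1 t2 &
     adm_triangulation (del_vertices [:: k; cyc m k.+1] (iota 1 m))
                       (neg_labels (del_tris [:: t1; t2] L))]).
  move=> ql; have rem := removable_square nc pM ql; have [km Mt E _] := ql.
  have [sh [c [cu t1c t2c]]] := ML _ _ Mt.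
  have sq : square m L k t1 t2 by exists c; split.
  split=> // om; exists k, t1, t2; split=> //.
  have sK : {subset [:: (t1, c); (t2, (- c)%R)] <= L} by move=> x; rewrite !inE => /orP[] /eqP ->.
  have uK : uniq [:: (t1, c); (t2, (- c)%R)].
    by have [[_ _ ut _] _ _ _ _] := rem; apply: (map_uniq (f := fst)).
  have [_ A2] := adm_del tri match_ uK sK rem w4; apply: A2.
  (* Two entries of [L] give [m >= 4], so nothing is truncated in [2 * (m - 4) + 2 = 2 * (m - 3)],
     which is divisible by 4 for odd [m]. *)
  by have := uniq_leq_size uK sK; rewrite weight_square szL /=; clear - om; lia.
case: (two_leaves nc pM Tm f1m m3) => [[ps Lp sub]|[ps [qs [Lp Lq dis]]]].
  (* A single piece that is a square or a triangle labelled -1 would make the weight of [L] equal to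
     2, which 4 does not divide. *)
  case: Lp => [[k [t [pst tl]]]|[k [t1 [t2 [pst ql]]]]]; rewrite pst in sub.
    case: (tri_cases _ _ tl) => [C1|[[tc _] _]]; first by right; left.
    have := perm_del_tris uL (K := [:: (t, (-1)%R)]) isT.
    move=> /(_ ltac:(by move=> x; rewrite inE => /eqP ->)) /weight_perm.
    rewrite (_ : del_tris _ _ = [::]); first by move=> W; move: w4; rewrite W.
    apply/eqP; rewrite -(negbK (_ == _)) -has_filter; apply/hasPn => x xL /=.
    by rewrite negbK; apply: sub; apply: map_f.
  have [_ Mt _ _] := ql; have [_ [c [cu t1c t2c]]] := ML _ _ Mt.
  have [[_ _ ut _] _ _ _ _] := removable_square nc pM ql.
  have uK : uniq [:: (t1, c); (t2, (- c)%R)] by apply: (map_uniq (f := fst)).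
  have := perm_del_tris uL uK.
  move=> /(_ ltac:(by move=> x; rewrite !inE => /orP[] /eqP ->)) /weight_perm.
  rewrite (_ : del_tris _ _ = [::]).
    by move=> W; move: w4; rewrite W weight_cat weight_square.
  apply/eqP; rewrite -(negbK (_ == _)) -has_filter; apply/hasPn => x xL /=.
  by rewrite negbK; apply: sub; apply: map_f.
(* A leaf labelled 1 gives (1). Otherwise, for odd [m] a square leaf gives (2) and two triangles
   give (5); for even [m] a triangle gives (3) and two squares give (4). *)
case: Lp => [[j [t [pst tl]]]|[j [t1 [t2 [pst ql]]]]]; rewrite pst in dis.
  case: (tri_cases _ _ tl) => [C1|[er C3]]; first by right; left.
  have [om|om] := boolP (odd m); last by right; right; right; left; split; last exact: C3.
  case: Lq => [[k [s [qst tl']]]|[k [s1 [s2 [_ ql']]]]]; last first.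
    by have [_ C2] := sq_cases _ _ _ ql'; right; right; left; split; last exact: C2.
  case: (tri_cases _ _ tl') => [C1|[er' _]]; first by right; left.
  do 5!right; exists j, k, t, s; rewrite qst in dis.
  have rem := removable_cat (removable_tri tl) (removable_tri tl') dis.
  have [[uvs _ uts _] _ _ _ _] := rem.
  have [/andP[j1 jm] tT _ E far] := tl; have [/andP[k1 km] sT _ E' far'] := tl'.
  have st : s != t by move: uts; rewrite /= inE andbT eq_sym.
  have kt : k \notin t by apply: contra st => /(far' _ tT) ->.
  have js : j \notin s by apply: contra st => /(far _ sT) ->.
  split=> //.
    rewrite j1 jm k1 km /=; move: uvs; rewrite /= inE andbT => jk.
    (* If [k] were [j.+1], it would be a vertex of the ear [t] at [j], but [s] is the only triangle
       at [k]. *)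
    have kj : k != j.+1.
      by apply: contra kt => /eqP kj; rewrite (perm_mem E) -kj (cyc_id k1 km) !inE eqxx !orbT.
    have jk1 : j != k.+1.
      by apply: contra js => /eqP jk1; rewrite (perm_mem E') -jk1 (cyc_id j1 jm) !inE eqxx !orbT.
    by clear - jk kj jk1; lia.
  have [tc _] := er; have [sc _] := er'.
  have sK : {subset [:: (t, (-1)%R); (s, (-1)%R)] <= L} by move=> x; rewrite !inE => /orP[] /eqP ->.
  have uK : uniq [:: (t, (-1)%R : int); (s, (-1)%R)] by apply: (map_uniq (f := fst)).
  by have [A1 _] := adm_del tri match_ uK sK rem w4; apply: A1.
have [sq C2] := sq_cases _ _ _ ql.
have [om|om] := boolP (odd m); first by right; right; left; split; last exact: C2.
case: Lq => [[k [s [qst tl']]]|[k [s1 [s2 [qst ql']]]]].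
  case: (tri_cases _ _ tl') => [C1|[_ C3]]; first by right; left.
  by right; right; right; left; split; last exact: C3.
have [sq' _] := sq_cases _ _ _ ql'; rewrite qst in dis.
do 4!right; left; exists j, k, t1, t2, s1, s2.
have rem := removable_cat (removable_square nc pM ql) (removable_square nc pM ql') dis.
have [[uvs _ uts _] _ _ _ _] := rem.
have [/andP[j1 jm] Mt _ _] := ql; have [/andP[k1 km] Ms _ _] := ql'.
split=> //.
  rewrite j1 jm k1 km /=; move: uvs; rewrite /= !inE !negb_or andbT.
  move=> /and3P[/and3P[_ jk jck] /andP[kcj _] _].
  (* If [k] were [j.+1], it would be deleted with both squares, but their deleted vertices are
     disjoint. *)
  have kj : k != j.+1.
    by apply: contra kcj => /eqP kj; rewrite -kj (cyc_id k1 km).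
  have jk1 : j != k.+1.
    by apply: contra jck => /eqP jk1; rewrite -jk1 (cyc_id j1 jm).
  by clear - jk kj jk1; lia.
have [_ [c [_ t1c t2c]]] := ML _ _ Mt; have [_ [d [_ s1d s2d]]] := ML _ _ Ms.
pose K := [:: (t1, c); (t2, (- c)%R)] ++ [:: (s1, d); (s2, (- d)%R)].
have sK : {subset K <= L} by move=> x; rewrite !inE => /or4P[] /eqP ->.
have uK : uniq K by apply: (map_uniq (f := fst)).
have [A1 _] := adm_del tri match_ uK sK rem w4; apply: A1.
by rewrite weight_cat !weight_square.
Qed.
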